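(* Any monotone Markovian selection rule is convex, and any strictly monotone Markovian selection rule is strictly convex. Here convex (resp. strictly convex) means that for every engine $i$, the selection probability $f_i(\mathbf q)=\pi_i$ is a convex (resp. strictly convex) function of $q_i$, with the satisfaction probabilities of the other engines held fixed.
   Context: Markovian selection rule: there are $K$ search engines, and each engine $i$ corresponds to a unique state $i$ of a process. The vector $\mathbf q=(q_1,\dots,q_K)\in[0,1]^K$ gives the satisfaction probabilities: $q_i$ is the probability that a user's query is satisfied (successful) when he uses engine $i$; otherwise the query fails. The user performs a walk on states, and always uses the engine corresponding to his current state. The transition probabilities depend on whether the user was satisfied in the previous round: $\tau^{(s)}_{i,j}$ and $\tau^{(f)}_{i,j}$ denote the probability of moving from state $i$ to state $j$ upon satisfaction or failure, respectively. The process has a stationary distribution $\pi$ (depending on $\mathbf q$), and the induced Markovian selection rule is $f_i(\mathbf q)=\pi_i$, interpreted as the probability that the user selects engine $i$. Return times: leaving state $i$ after a successful (resp. failed) query induces a distribution over the state of the process in the next round; in turn, that state defines an expected return time $R^{(s)}_i$ (resp. $R^{(f)}_i$) to state $i$, namely the expected number of rounds before the process returns to state $i$. Note that $R^{(s)}_i,R^{(f)}_i\ge1$. The Markov process is monotone if, for all $i$, $\tau^{(s)}_{i,i}\ge\tau^{(f)}_{i,i}$ and $R^{(s)}_i\le R^{(f)}_i$. (The first condition says that a user is no more likely to leave his current engine after a successful query than after a failed one; the second says that, conditioned on having left engine $i$, the last query having been successful does not increase the expected return time.) The process is strictly monotone if in addition the first inequality is strict. A Markovian selection rule is called (strictly)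 monotone if its Markov process is.
   Formalization: The strictly convex half assumes that the expected return times are finite for all satisfaction probabilities; otherwise an engine that is never returned to has selection probability identically 0, which is not strictly convex. The stationary distribution is taken to be unique. *)

(* Defs.v *)
From HB Require Import structures.
From mathcomp Require Import all_boot all_order all_algebra.
From mathcomp Require Import all_classical all_reals all_analysis.

Set Implicit Arguments.
Unset Strict Implicit.
Unset Printing Implicit Defensive.

Import Order.TTheory GRing.Theory Num.Theory.

Local Open Scope classical_set_scope.
Local Open Scope ring_scope.

Definition distribution_row (R : realType) (K : nat) (p : 'rV[R]_K) : Prop :=
  (forall i, 0 <= p 0 i) /\ \sum_i p 0 i = 1.

Definition stochastic (R : realType) (K : nat) (P : 'M[R]_K) : Prop :=
  forall i, distribution_row (row i P).

Definition in_cube (R : realType) (K : nat) (q : 'rV[R]_K) : Prop :=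
  forall i, 0 <= q 0 i <= 1.

Definition transition (R : realType) (K : nat) (ts tf : 'M[R]_K)
    (q : 'rV[R]_K) : 'M[R]_K :=
  \matrix_(i, j) (q 0 i * ts i j + (1 - q 0 i) * tf i j).

Definition stationary (R : realType) (K : nat) (P : 'M[R]_K)
    (p : 'rV[R]_K) : Prop :=
  distribution_row p /\ p *m P = p.

(* "The" stationary distribution depending on q: it exists and is unique. *)
Definition markovian_selection_rule (R : realType) (K : nat)
    (ts tf : 'M[R]_K) (f : 'rV[R]_K -> 'rV[R]_K) : Prop :=
  forall q, in_cube q ->
    stationary (transition ts tf q) (f q) /\
    (forall p, stationary (transition ts tf q) p -> p = f q).

(* Probability that the chain P started at j visits i for the first time
   after exactly n steps. *)
Fixpoint hitting_prob (R : realType) (K : nat) (P : 'M[R]_K) (i : 'I_K)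
    (n : nat) (j : 'I_K) : R :=
  match n with
  | 0%N => (j == i)%:R
  | m.+1 => if j == i then 0 else \sum_k P j k * hitting_prob P i m k
  end.

(* The hitting time takes values in N u {+oo}; the second term is the
   contribution of the event that i is never visited (with +oo * 0 = 0). *)
Definition expected_hitting_time (R : realType) (K : nat) (P : 'M[R]_K)
    (i j : 'I_K) : \bar R :=
  (\sum_(0 <= n <oo) (n%:R * hitting_prob P i n j)%:E +
   +oo * (1 - \sum_(0 <= n <oo) (hitting_prob P i n j)%:E))%E.

(* Expected number of rounds until the return to i, counted from the round
   after the departure, when the departure from i follows t conditioned on
   having left i, and the process then evolves according to P.  With t = ts
   (resp. tf) and P = transition ts tf q this is R^(s)_i (resp. R^(f)_i).
   Meaningful only when t i i < 1. *)
Definition return_time (R : realType) (K : nat) (t P : 'M[R]_K)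
    (i : 'I_K) : \bar R :=
  (\sum_(j | j != i) (t i j / (1 - t i i))%:E * expected_hitting_time P i j)%E.

(* When ts i i = 1, engine i is never left after a success, so R^(s)_i is
   undefined and there is nothing to compare. *)
Definition monotone_process (R : realType) (K : nat) (ts tf : 'M[R]_K) : Prop :=
  forall i, tf i i <= ts i i /\
    (ts i i < 1 -> forall q, in_cube q ->
       (return_time ts (transition ts tf q) i <=
        return_time tf (transition ts tf q) i)%E).

Definition strictly_monotone_process (R : realType) (K : nat)
    (ts tf : 'M[R]_K) : Prop :=
  monotone_process ts tf /\ forall i, tf i i < ts i i.

Definition finite_return_times (R : realType) (K : nat)
    (ts tf : 'M[R]_K) : Prop :=
  forall i q, in_cube q ->
    (ts i i < 1 -> (return_time ts (transition ts tf q) i < +oo)%E) /\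
    (tf i i < 1 -> (return_time tf (transition ts tf q) i < +oo)%E).

Local Open Scope convex_scope.

(* Strict analogue of [convex_function]. *)
Definition strictly_convex_function (R : numFieldType) (E : lmodType R)
    (E' := convex_lmodType E) (D : set E') (f : E' -> R^o) : Prop :=
  forall t : {i01 R}, 0 < t%:num < 1 ->
    {in D &, forall x y : E', x != y ->
      (f (x <| t |> y) < f x <| t |> f y)%R}.

Local Close Scope convex_scope.

Definition set_coord (R : realType) (K : nat) (q : 'rV[R]_K) (i : 'I_K)
    (x : R) : 'rV[R]_K :=
  \row_j (if j == i then x else q 0 j).

Definition convex_rule (R : realType) (K : nat)
    (f : 'rV[R]_K -> 'rV[R]_K) : Prop :=
  forall i q, in_cube q ->
    @convex_function R R^o `[0, 1] (fun x => f (set_coord q i x) 0 i).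

Definition strictly_convex_rule (R : realType) (K : nat)
    (f : 'rV[R]_K -> 'rV[R]_K) : Prop :=
  forall i q, in_cube q ->
    @strictly_convex_function R R^o `[0, 1] (fun x => f (set_coord q i x) 0 i).

(* Main.v *)
Require Import Defs.
From mathcomp Require Import all_boot all_order all_algebra.
From mathcomp Require Import all_classical all_reals all_analysis.
From mathcomp Require Import ring lra.

(* Write [pi] for the stationary distribution. Dividing it by [pi_i] gives an
   invariant measure of mass 1 at [i], that is, a solution of an affine system
   in which [q_i] enters only through row [i] of the transition matrix. Hence,
   by uniqueness, either [pi_i] vanishes for all values of [q_i], or [1 / pi_i]
   is an affine function of [q_i]; in both cases [pi_i] is convex, by the
   inequality between the harmonic and arithmetic means.
   Strict convexity only requires this affine function to be nonconstant. By
   Kac's formula [1 / pi_i] is the expected return time to [i], which is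
   [1 + (1 - tf i i) * Rf] at [q_i = 0] and [1 + (1 - ts i i) * Rs] at
   [q_i = 1], where [Rs <= Rf] and [1 <= Rf] do not depend on [q_i]. *)

Set Implicit Arguments.
Unset Strict Implicit.
Unset Printing Implicit Defensive.

Import Order.TTheory GRing.Theory Num.Theory.
Import numFieldNormedType.Exports.

Local Open Scope classical_set_scope.
Local Open Scope ring_scope.

(** * Limits of finite sums, and the harmonic mean *)

Lemma cvgn_sum (R : realType) (I : finType) (P : pred I) (u : I -> R^nat)
    (l : I -> R) :
  (forall i, P i -> u i n @[n --> \oo] --> l i) ->
  \sum_(i | P i) u i n @[n --> \oo] --> \sum_(i | P i) l i.
Proof.
by move=> ul; apply: cvg_big => //; exact: add_continuous.
Qed.

(** The gap between the two means factors as [t * (1 - t) * (a - b) ^+ 2] times the positive number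
    [(a * b * h)^-1], which settles the inequality and its equality case together. *)
Lemma harmonic_mean_le (R : realFieldType) (a b t : R) :
  0 < a -> 0 < b -> 0 <= t <= 1 ->
  (t * a^-1 + (1 - t) * b^-1)^-1 <= t * a + (1 - t) * b ?= iff
    (t * (1 - t) * (a - b) ^+ 2 == 0).
Proof.
move=> a0 b0 /andP[t0 t1].
have [a_neq0 b_neq0] := (lt0r_neq0 a0, lt0r_neq0 b0).
set h := t * a^-1 + _.
have h0 : 0 < h.
  rewrite /h; have [->|tn0] := eqVneq t 0.
    by rewrite mul0r add0r subr0 mul1r invr_gt0.
  apply: ltr_pwDl; first by rewrite divr_gt0// lt_neqAle eq_sym tn0.
  by rewrite divr_ge0 ?subr_ge0// ltW.
have E : t * a + (1 - t) * b - h^-1 =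
    (a * b * h)^-1 * (t * (1 - t) * (a - b) ^+ 2).
  have hE : h = (t * b + (1 - t) * a) / (a * b) by rewrite /h; field; rewrite a_neq0 b_neq0.
  have D0 : t * b + (1 - t) * a != 0.
    by apply: contraTN h0 => /eqP D0; rewrite hE D0 mul0r ltxx.
  by rewrite hE; field; rewrite b_neq0 a_neq0.
have c0 : 0 < (a * b * h)^-1 by rewrite invr_gt0 !mulr_gt0.
split.
  by rewrite -subr_ge0 E pmulr_rge0// mulr_ge0 ?sqr_ge0// mulr_ge0 ?subr_ge0.
by rewrite eq_sym -subr_eq0 E mulf_eq0 (gt_eqF c0).
Qed.

(** * The chain killed at [i], and its invariant measure *)

Section ChainKilledAtReturn.
Variables (R : realType) (K : nat).
Implicit Types (P t : 'M[R]_K) (i j : 'I_K) (p : 'rV[R]_K).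

Lemma stochastic_ge0 P i j : stochastic P -> 0 <= P i j.
Proof. by move=> /(_ i)[/(_ j)]; rewrite mxE. Qed.

Lemma stochastic_sum P i : stochastic P -> \sum_j P i j = 1.
Proof. by move=> /(_ i)[_ <-]; apply: eq_bigr => j _; rewrite mxE. Qed.

(** Row [i] is cleared rather than column [i]: a step into [i] keeps its weight, and the mass is
    lost only at the next step. The matrix is thus independent of row [i] of [P]. *)
Definition taboo P i : 'M[R]_K := \matrix_(j, k) (if j == i then 0 else P j k).

(* Entry [j] is the probability that the chain started at [j] does not visit
   [i] at times [0, ..., n - 1]. *)
Definition survival P i n : 'cV[R]_K := taboo P i ^+ n *m const_mx 1.

Lemma survival0 P i j : survival P i 0 j 0 = 1.
Proof. by rewrite /survival expr0 mul1mx mxE. Qed.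

Lemma survivalS P i n j :
  survival P i n.+1 j 0 =
  if j == i then 0 else \sum_k P j k * survival P i n k 0.
Proof.
rewrite /survival exprS -mulmxA mxE; case: eqVneq => [->|ji].
  by rewrite big1// => k _; rewrite mxE eqxx mul0r.
by apply: eq_bigr => k _; rewrite mxE (negPf ji).
Qed.

Lemma survival_ge0 P i n j : stochastic P -> 0 <= survival P i n j 0.
Proof.
move=> hP; elim: n j => [|n IH] j; first by rewrite survival0.
rewrite survivalS; case: ifP => // _; apply: sumr_ge0 => k _.
by rewrite mulr_ge0// stochastic_ge0.
Qed.

(** A first visit at time [n] means avoiding [i] before time [n] but not through time [n]. Sums of
    hitting probabilities therefore telescope. *)
Lemma hitting_prob_survival P i n j : stochastic P ->
  hitting_prob P i n j = survival P i n j 0 - survival P i n.+1 j 0.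
Proof.
move=> hP; elim: n j => [|n IH] j.
  rewrite survival0 survivalS /=; case: eqP => _; first by rewrite subr0.
  under eq_bigr do rewrite survival0 mulr1.
  by rewrite stochastic_sum// subrr.
rewrite survivalS survivalS /=; case: eqP => _; first by rewrite subr0.
by rewrite -sumrB; apply: eq_bigr => k _; rewrite IH mulrBr.
Qed.

Lemma hitting_prob_ge0 P i n j : stochastic P -> 0 <= hitting_prob P i n j.
Proof.
move=> hP; elim: n j => [|n IH] j /=; first by case: eqP.
case: ifP => // _; apply: sumr_ge0 => k _.
by rewrite mulr_ge0// stochastic_ge0.
Qed.

(** Used to see that survival probabilities do not change with [q_i]. *)
Lemma eq_taboo P P' i : (forall j, j != i -> row j P = row j P') ->
  taboo P i = taboo P' i.
Proof.
move=> PP'; apply/matrixP => j k; rewrite !mxE; case: eqVneq => // /PP'.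
by move=> /rowP/(_ k); rewrite !mxE.
Qed.

(* Kac's formula: the expected numbers of visits to the states between two
   visits to [i] form an invariant measure of mass [E] giving mass 1 to [i]. *)
Lemma stationary_inv_return P i (E : R) : stochastic P ->
  \sum_(0 <= n < N) (row i P *m survival P i n) 0 0 @[N --> \oo] --> E ->
  0 < E /\ exists2 p, stationary P p & p 0 i = E^-1.
Proof.
move=> hP cE; pose a n : 'rV[R]_K := row i P *m taboo P i ^+ n.
have Q0 j k : 0 <= taboo P i j k.
  by rewrite mxE; case: ifP => // _; exact: stochastic_ge0.
have a0 n j : 0 <= a n 0 j.
  elim: n j => [|n IH] j.
    by rewrite /a expr0 mulmx1 mxE stochastic_ge0.
  by rewrite /a exprSr mulmxA mxE sumr_ge0// => k _; rewrite mulr_ge0.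
have sa n : (row i P *m survival P i n) 0 0 = \sum_j a n 0 j.
  rewrite /survival mulmxA mxE; apply: eq_bigr => j _.
  by rewrite [const_mx _ _ _]mxE mulr1.
(* Expected number of visits to [j] during the first [N] steps after leaving [i], up to and
   including the first return. *)
pose V N j : R := \sum_(0 <= n < N) a n 0 j.
have ndV j : nondecreasing_seq (V ^~ j).
  by apply/nondecreasing_seqP => n; rewrite /V big_nat_recr//= lerDl.
have sV N : \sum_(0 <= n < N) (row i P *m survival P i n) 0 0 = \sum_j V N j.
  by rewrite exchange_big; apply: eq_bigr => n _; rewrite sa.
have ndE : nondecreasing_seq
    (fun N => \sum_(0 <= n < N) (row i P *m survival P i n) 0 0).
  apply/nondecreasing_seqP => n; rewrite big_nat_recr//= lerDl sa.
  exact: sumr_ge0.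
(* This bound makes the nondecreasing sequences [V ^~ j] converge. *)
have VE N j : V N j <= E.
  have -> : E = limn (fun N => \sum_(0 <= n < N)
      (row i P *m survival P i n) 0 0) by exact/esym/cvg_lim.
  apply: le_trans (nondecreasing_cvgn_le ndE _ N); last by apply/cvg_ex; exists E.
  rewrite sV (bigD1 j)//= lerDl sumr_ge0// => k _.
  by apply: sumr_ge0 => n _.
pose v : 'rV[R]_K := \row_j limn (V ^~ j).
have cV j : V N j @[N --> \oo] --> v 0 j.
  rewrite mxE; apply: nondecreasing_is_cvgn => //.
  by exists E => _ [N _ <-].
have v0 j : 0 <= v 0 j.
  apply: (cvgr_to_ge (cV j)); near=> N; exact: sumr_ge0.
have sv : \sum_j v 0 j = E.
  move: cE; under eq_cvg do rewrite sV; move=> cE.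
  apply: (cvg_unique (@Rhausdorff R) _ cE).
  by apply: cvgn_sum => j _; exact: cV.
have VQ N j : V N.+1 j = P i j + \sum_k V N k * taboo P i k j.
  rewrite /V big_nat_recl//= {1}/a expr0 mulmx1 mxE; congr (_ + _).
  under [RHS]eq_bigr do rewrite mulr_suml.
  rewrite exchange_big; apply: eq_bigr => n _.
  by rewrite /a exprSr mulmxA mxE.
have vQ j : v 0 j = P i j + \sum_k v 0 k * taboo P i k j.
  have := cV j; rewrite -cvg_shiftS /=; under eq_cvg do rewrite VQ.
  move=> cVj; apply: (cvg_unique (@Rhausdorff R) cVj).
  apply: cvgD; first exact: cvg_cst.
  by apply: cvgn_sum => k _; apply: cvgMl; exact: cV.
(* Summing [vQ] over [j]: every row of [taboo P i] other than row [i] has sum 1, so the masses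
   outside [i] cancel and only [v 0 i = 1] remains. *)
have vi : v 0 i = 1.
  have vQsum : \sum_j \sum_k v 0 k * taboo P i k j = \sum_(j | j != i) v 0 j.
    rewrite exchange_big (bigD1 i)//= big1 ?add0r; last first.
      by move=> j _; rewrite [taboo _ _ _ _]mxE eqxx mulr0.
    apply: eq_bigr => k ki; rewrite -mulr_sumr.
    under eq_bigr do rewrite [taboo _ _ _ _]mxE (negPf ki).
    by rewrite stochastic_sum// mulr1.
  have : \sum_j v 0 j = 1 + \sum_(j | j != i) v 0 j.
    rewrite -vQsum -(stochastic_sum i hP) -big_split.
    by apply: eq_bigr => j _; exact: vQ.
  by rewrite (bigD1 i)//= => /addIr.
have E0 : 0 < E.
  by rewrite -sv (bigD1 i)//= vi ltr_pwDl// sumr_ge0.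
split=> //; exists (E^-1 *: v); last by rewrite mxE vi mulr1.
split; first split.
- by move=> j; rewrite mxE mulr_ge0// invr_ge0 ltW.
- under eq_bigr do rewrite mxE.
  by rewrite -mulr_sumr sv mulVf// gt_eqF.
(* Since [v 0 i = 1], the term [P i j] of [vQ] is exactly the contribution of row [i] that [taboo]
   removed. *)
- rewrite -scalemxAl; congr (_ *: _); apply/rowP => j.
  rewrite mxE vQ (bigD1 i)//= vi mul1r; congr (_ + _).
  rewrite [RHS](bigD1 i)//= [taboo _ _ _ _]mxE eqxx mulr0 add0r.
  by apply: eq_bigr => k ki; rewrite [taboo _ _ _ _]mxE (negPf ki).
Unshelve. all: by end_near.
Qed.

(** * Expected hitting and return times as series of survival probabilities *)

Lemma hitting_prob_series P i j N : stochastic P ->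
  \sum_(0 <= n < N) hitting_prob P i n j = 1 - survival P i N j 0.
Proof.
move=> hP; elim: N => [|N IH]; first by rewrite big_geq// survival0 subrr.
by rewrite big_nat_recr//= IH hitting_prob_survival//; ring.
Qed.

Lemma expected_hitting_time_ge0 P i j : stochastic P ->
  (0 <= expected_hitting_time P i j)%E.
Proof.
move=> hP; apply: adde_ge0.
  by apply: nneseries_ge0 => n _ _; rewrite lee_fin mulr_ge0// hitting_prob_ge0.
apply: mule_ge0 => //; rewrite subre_ge0.
apply: lime_le.
  by apply: is_cvg_nneseries => n _ _; rewrite lee_fin hitting_prob_ge0.
near=> N; rewrite sumEFin lee_fin hitting_prob_series// gerBl.
exact: survival_ge0.
Unshelve. all: by end_near.
Qed.

Lemma nneseries_fin_cvg (u : R^nat) (l : R) : (forall n, 0 <= u n) ->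
  (\sum_(0 <= n <oo) (u n)%:E = l%:E)%E ->
  \sum_(0 <= n < N) u n @[N --> \oo] --> l.
Proof.
move=> u0 ul.
have : (\sum_(0 <= n < N) (u n)%:E)%E @[N --> \oo] --> l%:E.
  by rewrite -ul; apply: is_cvg_nneseries => n _ _; rewrite lee_fin.
move=> /fine_cvg; apply: cvg_trans; apply: near_eq_cvg; near=> N.
by rewrite /= sumEFin.
Unshelve. all: by end_near.
Qed.

(* Summation by parts; the boundary term [N * survival N] is controlled by the
   tail of the series of the [n * hitting_prob n]. *)
Lemma expected_hitting_time_survival P i j : stochastic P ->
  (expected_hitting_time P i j < +oo)%E ->
  \sum_(0 <= n < N) survival P i n.+1 j 0 @[N --> \oo] -->
    fine (expected_hitting_time P i j).
Proof.
move=> hP; rewrite /expected_hitting_time.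
have h0 n : 0 <= hitting_prob P i n j by exact: hitting_prob_ge0.
have nh0 n : 0 <= n%:R * hitting_prob P i n j by rewrite mulr_ge0.
set A := (\sum_(0 <= n <oo) (n%:R * _)%:E)%E.
set B := (\sum_(0 <= n <oo) (hitting_prob _ _ _ _)%:E)%E.
have A0 : (0 <= A)%E by apply: nneseries_ge0 => n _ _; rewrite lee_fin.
have B0 : (0 <= B)%E by apply: nneseries_ge0 => n _ _; rewrite lee_fin.
have B1 : (B <= 1)%E.
  apply: lime_le.
    by apply: is_cvg_nneseries => n _ _; rewrite lee_fin.
  near=> N; rewrite sumEFin lee_fin hitting_prob_series// gerBl.
  exact: survival_ge0.
(* If [i] is missed with positive probability, the [+oo] term makes the expectation infinite,
   against the hypothesis. *)
have [B1E|Bneq1] := eqVneq B 1%E; last first.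
  rewrite gt0_mulye ?addey// ?sube_gt0 ?lt_neqAle ?Bneq1//.
  by rewrite -ltNye (lt_le_trans _ A0).
rewrite B1E subee// mule0 adde0 => Afin.
have AE : A = (fine A)%:E by rewrite fineK// ge0_fin_numE.
have cA := nneseries_fin_cvg nh0 AE.
have cB := nneseries_fin_cvg h0 B1E.
set H := fine A in AE cA *.
pose w n := survival P i n j 0.
have cw : w N @[N --> \oo] --> 0.
  rewrite -(subrr 1); have -> : w = fun N => 1 - (1 - w N).
    by apply/funext => N; rewrite subKr.
  apply: cvgB; first exact: cvg_cst.
  by under eq_cvg do rewrite -hitting_prob_series//.
pose S N := \sum_(0 <= n < N) n%:R * hitting_prob P i n j.
have SE N : \sum_(0 <= n < N) w n.+1 = S N + N%:R * w N.
  elim: N => [|N IH]; first by rewrite /S !big_geq// mul0r addr0.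
  rewrite big_nat_recr//= IH /S big_nat_recr//= hitting_prob_survival//.
  by rewrite -/(w _) -/(w _) -natr1; ring.
have w0 n : 0 <= w n by exact: survival_ge0.
have Sle M : S M <= H.
  have -> : H = limn S by exact/esym/cvg_lim.
  apply: nondecreasing_cvgn_le; last by apply/cvg_ex; exists H.
  by apply/nondecreasing_seqP => n; rewrite /S big_nat_recr//= lerDl.
have upper N : \sum_(0 <= n < N) w n.+1 <= H.
  (* From index [N] on, the weights are at least [N] and the hitting probabilities telescope.
     Letting [N + m] tend to infinity bounds [N%:R * w N] by [H - S N]. *)
  have step m : S N + N%:R * (w N - w (N + m)%N) <= S (N + m)%N.
    elim: m => [|m IH]; first by rewrite addn0 subrr mulr0 addr0.
    rewrite addnS {2}/S big_nat_recr//= -/(S _).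
    have hE : hitting_prob P i (N + m) j = w (N + m)%N - w (N + m).+1.
      exact: hitting_prob_survival.
    have : N%:R * hitting_prob P i (N + m) j <=
        (N + m)%:R * hitting_prob P i (N + m) j.
      by rewrite ler_wpM2r// ler_nat leq_addr.
    rewrite hE; move: IH; nra.
  have cwN : H + N%:R * w M @[M --> \oo] --> H.
    rewrite -[X in _ --> X]addr0 -(mulr0 N%:R); apply: cvgD; first exact: cvg_cst.
    by apply: cvgMr.
  apply: (cvgr_to_ge cwN); near=> M.
  have NM : (N <= M)%N by near: M; exact: nbhs_infty_ge.
  have := step (M - N)%N; have := Sle M; rewrite subnKC// SE mulrBr; lra.
apply: (squeeze_cvgr _ cA (cvg_cst H)); near=> N.
by rewrite upper andbT SE lerDl mulr_ge0.
Unshelve. all: by end_near.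
Qed.

Lemma row_survival0 t P i : stochastic t -> (row i t *m survival P i 0) 0 0 = 1.
Proof.
move=> ht; rewrite mxE -(stochastic_sum i ht); apply: eq_bigr => j _.
by rewrite survival0 mxE mulr1.
Qed.

Lemma row_survivalS t P i n : (row i t *m survival P i n.+1) 0 0 =
  \sum_(j | j != i) t i j * survival P i n.+1 j 0.
Proof.
rewrite mxE (bigD1 i)//= survivalS eqxx mulr0 add0r.
by apply: eq_bigr => j _; rewrite mxE.
Qed.

(** The series is the tail sum of the time to come back to [i] when the first step follows [t]: one
    round for that step and, with probability [1 - t i i], a further [return_time] on average. *)
Lemma return_time_series t P i : stochastic t -> stochastic P -> t i i < 1 ->
  (return_time t P i < +oo)%E ->
  exists2 E : R, return_time t P i = E%:E &
    \sum_(0 <= n < N) (row i t *m survival P i n) 0 0 @[N --> \oo] -->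
      1 + (1 - t i i) * E.
Proof.
move=> ht hP ti; rewrite /return_time => fin.
pose H j := fine (expected_hitting_time P i j).
have c0 : 0 < 1 - t i i by rewrite subr_gt0.
have term0 j : (0 <= (t i j / (1 - t i i))%:E * expected_hitting_time P i j)%E.
  rewrite mule_ge0// ?expected_hitting_time_ge0// lee_fin mulr_ge0//.
    exact: stochastic_ge0.
  by rewrite invr_ge0 ltW.
(* Hitting times may be infinite from states with [t i j = 0], where the product is 0; all others
   must be finite. *)
have finH j : j != i -> t i j != 0 -> (expected_hitting_time P i j < +oo)%E.
  move=> ji tj; rewrite ltNge leye_eq; apply/negP => /eqP Hoo.
  move: fin; rewrite (bigD1 j)//= Hoo gt0_muley.
    rewrite addye ?ltxx// -ltNye (lt_le_trans ltNy0)//.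
    exact: sume_ge0.
  rewrite lte_fin divr_gt0// lt_neqAle eq_sym tj; exact: stochastic_ge0.
have termE j : j != i ->
    ((t i j / (1 - t i i))%:E * expected_hitting_time P i j)%E =
    (t i j / (1 - t i i) * H j)%:E.
  move=> ji; have [->|tj] := eqVneq (t i j) 0; first by rewrite !mul0r mul0e.
  rewrite [RHS]EFinM /H fineK// ge0_fin_numE ?finH//.
  exact: expected_hitting_time_ge0.
exists (\sum_(j | j != i) t i j / (1 - t i i) * H j).
  by rewrite -sumEFin; apply: eq_bigr.
have -> : (1 - t i i) * (\sum_(j | j != i) t i j / (1 - t i i) * H j) =
    \sum_(j | j != i) t i j * H j.
  rewrite mulr_sumr; apply: eq_bigr => j _; field.
  by rewrite gt_eqF.
(* The term of index 0, equal to 1, is split off; the others involve only positive survival times,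
   to which state [i] contributes nothing. *)
rewrite -cvg_shiftS /=.
have E N : \sum_(0 <= n < N.+1) (row i t *m survival P i n) 0 0 =
    1 + \sum_(j | j != i) t i j * \sum_(0 <= n < N) survival P i n.+1 j 0.
  rewrite big_nat_recl//= row_survival0//; congr (_ + _).
  under [RHS]eq_bigr do rewrite mulr_sumr.
  by rewrite exchange_big; apply: eq_bigr => n _; exact: row_survivalS.
under eq_cvg do rewrite E.
apply: cvgD; first exact: cvg_cst.
apply: cvgn_sum => j ji.
have [->|tj] := eqVneq (t i j) 0.
  by under eq_cvg do rewrite mul0r; rewrite mul0r; exact: cvg_cst.
apply: cvgMr; apply: expected_hitting_time_survival => //; exact: finH.
Qed.

End ChainKilledAtReturn.

(** * Stationary vectors when a single row changes *)

Section StationaryOfPerturbedRow.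
Variables (R : realType) (K : nat).
Implicit Types (P : 'M[R]_K) (p : 'rV[R]_K) (i : 'I_K).

Lemma mulmx_row_change P P' p i : (forall j, j != i -> row j P = row j P') ->
  p *m P' = p *m P + p 0 i *: (row i P' - row i P).
Proof.
move=> PP'; apply/rowP => k; rewrite !mxE (bigD1 i)//= [in RHS](bigD1 i)//=.
have -> : \sum_(j | j != i) p 0 j * P' j k = \sum_(j | j != i) p 0 j * P j k.
  by apply: eq_bigr => j /PP' /rowP/(_ k); rewrite !mxE => ->.
ring.
Qed.

Lemma stationary_row_change P P' p i :
  (forall j, j != i -> row j P = row j P') ->
  p 0 i = 0 -> stationary P p -> stationary P' p.
Proof.
move=> PP' pi0 [hp pP]; split => //.
by rewrite (mulmx_row_change _ PP') pi0 scale0r addr0.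
Qed.

(* Normalized to mass 1 at [i], a stationary vector is affine in row [i]. *)
Lemma stationary_row_mix P1 P2 P p1 p2 i (c : R) :
  0 <= c <= 1 ->
  (forall j, j != i -> row j P1 = row j P) ->
  (forall j, j != i -> row j P2 = row j P) ->
  row i P = c *: row i P1 + (1 - c) *: row i P2 ->
  stationary P1 p1 -> stationary P2 p2 -> 0 < p1 0 i -> 0 < p2 0 i ->
  exists2 p, stationary P p &
    p 0 i = (c * (p1 0 i)^-1 + (1 - c) * (p2 0 i)^-1)^-1.
Proof.
move=> /andP[c0 c1] h1 h2 hi [[p1_ge0 p1_sum] p1P] [[p2_ge0 p2_sum] p2P] a0 b0.
set a := p1 0 i in a0 *; set b := p2 0 i in b0 *.
(* Dividing by [a] and [b] gives both vectors mass 1 at [i], so [u] has mass 1 at [i] too, and total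
   mass [s]. *)
pose u := (c / a) *: p1 + ((1 - c) / b) *: p2.
set s := c * a^-1 + _.
have u_ge0 j : 0 <= u 0 j.
  by rewrite !mxE addr_ge0// mulr_ge0// divr_ge0// ?subr_ge0// ltW.
have usum : \sum_j u 0 j = s.
  under eq_bigr do rewrite !mxE.
  by rewrite big_split/= -!mulr_sumr p1_sum p2_sum !mulr1.
have ui : u 0 i = 1.
  by rewrite !mxE -/a -/b !mulfVK ?gt_eqF// addrC subrK.
have s0 : 0 < s.
  by rewrite -usum (bigD1 i)//= ui ltr_pwDl// sumr_ge0.
(* The two row corrections have weights [c] and [1 - c], and cancel because row [i] of [P] is the
   same mixture. *)
have uP : u *m P = u.
  rewrite /u mulmxDl -!scalemxAl (mulmx_row_change _ h1) (mulmx_row_change _ h2).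
  rewrite p1P p2P -/a -/b hi !scalerDr !scalerA !mulfVK ?gt_eqF//.
  apply/rowP => k; rewrite !mxE; ring.
exists (s^-1 *: u); last by rewrite mxE ui mulr1.
split; first split.
- by move=> j; rewrite mxE mulr_ge0// invr_ge0 ltW.
- under eq_bigr do rewrite mxE.
  by rewrite -mulr_sumr usum mulVf// gt_eqF.
- by rewrite -scalemxAl uP.
Qed.

End StationaryOfPerturbedRow.

(** * The selection probability as a function of [q_i] *)

Section SelectionProbability.
Variables (R : realType) (K : nat) (ts tf : 'M[R]_K).
Variable (f : 'rV[R]_K -> 'rV[R]_K).
Hypotheses (hs : stochastic ts) (hf : stochastic tf).
Hypothesis (hrule : markovian_selection_rule ts tf f).
Variables (q : 'rV[R]_K) (i : 'I_K).
Hypothesis (hq : in_cube q).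

Let P x := transition ts tf (set_coord q i x).
Let g x := f (set_coord q i x) 0 i.

Lemma set_coord_cube (x : R) : 0 <= x <= 1 -> in_cube (set_coord q i x).
Proof. by move=> x01 j; rewrite mxE; case: ifP. Qed.

Lemma transition_stochastic (q' : 'rV[R]_K) : in_cube q' ->
  stochastic (transition ts tf q').
Proof.
move=> hq' j; have /andP[q0 q1] := hq' j; split=> [k|].
  by rewrite !mxE addr_ge0// mulr_ge0 ?subr_ge0// stochastic_ge0.
under eq_bigr do rewrite !mxE.
rewrite big_split/= -!mulr_sumr !stochastic_sum//; ring.
Qed.

Lemma row_transition_coord x : row i (P x) = x *: row i ts + (1 - x) *: row i tf.
Proof. by apply/rowP => k; rewrite !mxE eqxx. Qed.

Lemma row_transition_coord_neq x y j : j != i -> row j (P x) = row j (P y).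
Proof. by move=> ji; apply/rowP => k; rewrite !mxE (negPf ji). Qed.

Lemma selection_ge0 x : 0 <= x <= 1 -> 0 <= g x.
Proof. by move=> /set_coord_cube /hrule[[[+ _] _] _]; exact. Qed.

(** A stationary distribution that does not charge [i] never uses row [i], so it remains stationary
    when [q_i] changes; uniqueness concludes. *)
Lemma selection_eq0 x y : 0 <= x <= 1 -> 0 <= y <= 1 -> g x = 0 -> g y = 0.
Proof.
move=> /set_coord_cube /hrule[sx _] /set_coord_cube /hrule[_ uy] gx.
rewrite /g -(uy _ (stationary_row_change _ gx sx)) => [//|j ji].
exact: row_transition_coord_neq.
Qed.

Lemma selection_inv_affine (x y c : R) :
  0 <= x <= 1 -> 0 <= y <= 1 -> 0 <= c <= 1 -> 0 < g x -> 0 < g y ->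
  g (c * x + (1 - c) * y) = (c * (g x)^-1 + (1 - c) * (g y)^-1)^-1.
Proof.
move=> x01 y01 c01 gx gy; set z := c * x + _.
have z01 : 0 <= z <= 1.
  by move: x01 y01 c01 => /andP[? ?] /andP[? ?] /andP[? ?]; rewrite /z; nra.
have [sx _] := hrule (set_coord_cube x01).
have [sy _] := hrule (set_coord_cube y01).
have [_ uz] := hrule (set_coord_cube z01).
have hi : row i (P z) = c *: row i (P x) + (1 - c) *: row i (P y).
  by rewrite !row_transition_coord; apply/rowP => k; rewrite !mxE /z; ring.
have [p sp pE] := stationary_row_mix c01
  (fun j ji => row_transition_coord_neq x z ji)
  (fun j ji => row_transition_coord_neq y z ji) hi sx sy gx gy.
by rewrite /g -(uz _ sp).
Qed.

(** Survival is taken under [P 0] for every [x], which is legitimate because the killed chain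
    ignores row [i]. The values at 0 and 1 thus become comparable through return times of one
    chain. *)
Lemma selection_kac (x E : R) : 0 <= x <= 1 ->
  \sum_(0 <= n < N) (row i (P x) *m survival (P 0) i n) 0 0 @[N --> \oo] --> E ->
  0 < E /\ g x = E^-1.
Proof.
move=> x01; have hx := set_coord_cube x01.
have sE n : survival (P 0) i n = survival (P x) i n.
  rewrite /survival (@eq_taboo _ _ (P 0) (P x))// => j.
  exact: row_transition_coord_neq.
under eq_cvg do under eq_bigr do rewrite sE.
move=> /(stationary_inv_return (transition_stochastic hx))[E0 [p sp <-]].
by have [_ /(_ _ sp) ->] := hrule hx.
Qed.

Lemma row_transition0 : row i (P 0) = row i tf.
Proof. by rewrite row_transition_coord scale0r add0r subr0 scale1r. Qed.

Lemma row_transition1 : row i (P 1) = row i ts.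
Proof. by rewrite row_transition_coord subrr scale0r addr0 scale1r. Qed.

Lemma selection_coord0_lt_coord1 : finite_return_times ts tf ->
  strictly_monotone_process ts tf -> 0 < g 0 < g 1.
Proof.
move=> hfin [hmon /(_ i) sti]; have := hmon i => -[_ hret].
have z01 : 0 <= (0 : R) <= 1 by rewrite lexx ler01.
have o01 : 0 <= (1 : R) <= 1 by rewrite lexx ler01.
have hP0 := transition_stochastic (set_coord_cube z01).
have ts1 : ts i i <= 1.
  by rewrite -(stochastic_sum i hs) (bigD1 i)//= lerDl sumr_ge0// => j _;
     exact: stochastic_ge0.
have tf1 : tf i i < 1 by exact: lt_le_trans ts1.
have [fins finf] := hfin i _ (set_coord_cube z01).
have [T TE cT] := return_time_series hf hP0 tf1 (finf tf1).
have s_ge0 n j : 0 <= survival (P 0) i n j 0 by exact: survival_ge0.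
(* The first two terms of the series are already [1] and [1 - tf i i], since a start outside [i]
   survives time 0. *)
have T1 : 1 <= T.
  have : 1 + (1 - tf i i) <= 1 + (1 - tf i i) * T.
    apply: (cvgr_to_ge cT); near=> N.
    have N2 : (2 <= N)%N by near: N; exact: nbhs_infty_ge.
    rewrite -(subnKC N2) !addSn add0n big_nat_recl//= big_nat_recl//=.
    rewrite row_survival0// row_survivalS lerD2l -[leLHS]addr0 lerD//.
      have := stochastic_sum i hf; rewrite (bigD1 i)//= addrC => /(canRL (addrK _)) <-.
      apply: ler_sum => j ji; rewrite survivalS (negPf ji).
      under eq_bigr do rewrite survival0 mulr1.
      by rewrite stochastic_sum// mulr1.
    rewrite sumr_ge0// => n _; rewrite row_survivalS sumr_ge0// => j _.
    by rewrite mulr_ge0// stochastic_ge0.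
  by rewrite lerD2l -{1}[1 - tf i i]mulr1 ler_pM2l// subr_gt0.
have [S S_lt cS] : exists2 S : R, S < 1 + (1 - tf i i) * T &
    \sum_(0 <= n < N) (row i ts *m survival (P 0) i n) 0 0 @[N --> \oo] --> S.
  have [ts_lt1|] := ltP (ts i i) 1.
    have [S SE cS] := return_time_series hs hP0 ts_lt1 (fins ts_lt1).
    exists (1 + (1 - ts i i) * S) => //.
    have := hret ts_lt1 _ (set_coord_cube z01); rewrite SE TE lee_fin => ST.
    (* The second, strict inequality combines [tf i i < ts i i] with [0 < T]. *)
    rewrite ltrD2l; apply: (@le_lt_trans _ _ ((1 - ts i i) * T)).
      by rewrite ler_wpM2l// subr_ge0.
    by rewrite ltr_pM2r ?ltrD2l ?ltrN2//; exact: lt_le_trans T1.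
  (* If [i] is absorbing under success, the return happens in one round. *)
  move=> ts_ge1; have tsE : ts i i = 1 by apply/eqP; rewrite eq_le ts1.
  have ts0 j : j != i -> ts i j = 0.
    have /psumr_eq0P : \sum_(j | j != i) ts i j = 0.
      by have := stochastic_sum i hs; rewrite (bigD1 i)//= tsE; lra.
    by apply => k _; exact: stochastic_ge0.
  exists 1; first by rewrite ltrDl mulr_gt0 ?subr_gt0//; exact: lt_le_trans T1.
  rewrite -cvg_shiftS /=.
  under eq_cvg => N.
    rewrite big_nat_recl//= row_survival0// big1 ?addr0 => [|n _]; last first.
      by rewrite row_survivalS big1// => j ji; rewrite ts0// mul0r.
    over.
  exact: cvg_cst.
have [T0 ->] : 0 < 1 + (1 - tf i i) * T /\ g 0 = (1 + (1 - tf i i) * T)^-1.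
  by apply: selection_kac => //; rewrite row_transition0.
have [S0 ->] : 0 < S /\ g 1 = S^-1.
  by apply: selection_kac => //; rewrite row_transition1.
by rewrite invr_gt0 T0 ltf_pV2.
Unshelve. all: by end_near.
Qed.

Lemma selection_zero_or_gt0 :
  (forall x, 0 <= x <= 1 -> g x = 0) \/ (forall x, 0 <= x <= 1 -> 0 < g x).
Proof.
have z01 : 0 <= (0 : R) <= 1 by rewrite lexx ler01.
have [g0|g0] := eqVneq (g 0) 0; [left|right] => x x01.
  exact: selection_eq0 g0.
rewrite lt_neqAle selection_ge0// andbT eq_sym; apply: contra g0 => /eqP gx.
exact/eqP/(selection_eq0 x01).
Qed.

Lemma selection_convex (x y c : R) :
  0 <= x <= 1 -> 0 <= y <= 1 -> 0 <= c <= 1 ->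
  g (c * x + (1 - c) * y) <= c * g x + (1 - c) * g y.
Proof.
move=> x01 y01 c01; have [g0|g0] := selection_zero_or_gt0.
  rewrite !g0 ?mulr0 ?addr0//.
  by move: x01 y01 c01 => /andP[? ?] /andP[? ?] /andP[? ?]; nra.
by rewrite selection_inv_affine ?g0// harmonic_mean_le ?g0.
Qed.

Lemma selection_strictly_convex (x y c : R) : 0 < g 0 < g 1 ->
  0 <= x <= 1 -> 0 <= y <= 1 -> 0 < c < 1 -> x != y ->
  g (c * x + (1 - c) * y) < c * g x + (1 - c) * g y.
Proof.
move=> /andP[g0 g01] x01 y01 /andP[c0 c1] xy.
have g1 : 0 < g 1 by exact: lt_trans g01.
have z01 : 0 <= (0 : R) <= 1 by rewrite lexx ler01.
have o01 : 0 <= (1 : R) <= 1 by rewrite lexx ler01.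
(* The affine formula between the endpoints 1 and 0, with weight [z]; as its end values differ, [g]
   is injective and the means of [g x] and [g y] are distinct. *)
have gE z : 0 <= z <= 1 -> (g z)^-1 = z * (g 1)^-1 + (1 - z) * (g 0)^-1.
  move=> z_01; have := selection_inv_affine o01 z01 z_01 g1 g0.
  by rewrite mulr1 mulr0 addr0 => ->; rewrite invrK.
have g_gt0 z : 0 <= z <= 1 -> 0 < g z.
  have [g_eq0|g_gt0] := selection_zero_or_gt0; last exact: g_gt0.
  by rewrite g_eq0// ltxx in g0.
have c01 : 0 <= c <= 1 by rewrite !ltW.
rewrite selection_inv_affine ?g_gt0//.
rewrite (lt_leif (harmonic_mean_le (g_gt0 _ x01) (g_gt0 _ y01) c01)).
rewrite !mulf_eq0 gt_eqF// gt_eqF ?subr_gt0//= orbb subr_eq0.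
apply: contra xy => /eqP /(congr1 GRing.inv); rewrite (gE x)// (gE y)// => gxy.
have : (x - y) * ((g 1)^-1 - (g 0)^-1) = 0 by move: gxy; lra.
move/eqP; rewrite mulf_eq0 subr_eq0 => /orP[//|].
by rewrite subr_eq0 (inj_eq invr_inj) gt_eqF.
Qed.

End SelectionProbability.

Theorem theorem6p1 (R : realType) (K : nat) (ts tf : 'M[R]_K)
    (f : 'rV[R]_K -> 'rV[R]_K)
    (hs : stochastic ts) (hf : stochastic tf)
    (hrule : markovian_selection_rule ts tf f) :
  (monotone_process ts tf -> convex_rule f) /\
  (finite_return_times ts tf -> strictly_monotone_process ts tf ->
    strictly_convex_rule f).
Proof.
split=> [_ i q hq c x y|hfin hmon i q hq c c01 x y].
  move=> /set_mem; rewrite /= in_itv/= => x01 /set_mem; rewrite /= in_itv/= => y01.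
  have c01 : 0 <= c%:num <= 1 by rewrite ge0 le1.
  exact: (selection_convex hrule i hq x01 y01 c01).
move=> /set_mem; rewrite /= in_itv/= => x01.
move=> /set_mem; rewrite /= in_itv/= => y01 xy.
have g01 := selection_coord0_lt_coord1 hs hf hrule i hq hfin hmon.
exact: (selection_strictly_convex hrule hq g01 x01 y01 c01 xy).
Qed.
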